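(* The joint right spectrum of the $n$-tuple of left creation operators $L=(L_1,\dots,L_n)$ on $\mathcal{H}_n$ is the closed unit ball of $\mathbb{C}^n$: $$\sigma_r(L)=\overline{\mathbb{B}}_n,\qquad \mathbb{B}_n=\{\lambda\in\mathbb{C}^n:\|\lambda\|_2<1\}.$$
   Context: Let $n\ge 2$, let $\mathbb{F}_n^+$ be the unital free semigroup on $n$ noncommuting letters $\{1,\dots,n\}$, and let $\mathcal{H}_n=\ell^2(\mathbb{F}_n^+)$ with orthonormal basis $\{\xi_w:w\in\mathbb{F}_n^+\}$. The left creation operators $L_i\in\mathcal{B}(\mathcal{H}_n)$ are defined by $L_i\xi_w=\xi_{iw}$. For an $n$-tuple $A=(A_1,\dots,A_n)$ of bounded operators on a Hilbert space $\mathcal{H}$, the joint right spectrum $\sigma_r(A)$ is the set of $\lambda=(\lambda_1,\dots,\lambda_n)\in\mathbb{C}^n$ for which there is no $n$-tuple $B=(B_1,\dots,B_n)$ of bounded operators on $\mathcal{H}$ with $\sum_{i=1}^n(A_i-\lambda_iI)B_i=I$. *)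

(* Defs.v *)
From HB Require Import structures.
From mathcomp Require Import all_boot all_order all_algebra complex.
From mathcomp Require Import all_classical all_reals all_analysis.
From mathcomp Require Import ring.

Set Implicit Arguments.
Unset Strict Implicit.
Unset Printing Implicit Defensive.
Import Order.TTheory GRing.Theory Num.Theory.
Import numFieldNormedType.Exports.
Import ComplexField.

Local Open Scope classical_set_scope.
Local Open Scope complex_scope.
Local Open Scope ring_scope.

(* [normc z : R] is the modulus of [z]; MathComp's [`|z|] is its image in
   [R[i]], the type in which the norms of complex normed modules live. *)
Notation normc := Normc.normc.

HB.instance Definition _ (R : rcfType) :=
  NormedModule.copy R[i] (R[i] : numClosedFieldType)^o.

Section SquareSummable.
Context {R : realType} {I : choiceType}.
Implicit Types f g : I -> R[i].

Definition l2sum f : \bar R := \esum_(i in [set: I]) (normc (f i) ^+ 2)%:E.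

Definition square_summable : {pred I -> R[i]} := fun f => (l2sum f < +oo)%E.

Lemma normcR (z : R[i]) : `|z| = (normc z)%:C.
Proof. by rewrite normc_def; case: z. Qed.

Lemma normc_ge0 (z : R[i]) : 0 <= normc z.
Proof. by case: z => a b; exact: sqrtr_ge0. Qed.

Lemma ler_normcD (y z : R[i]) : normc (y + z) <= normc y + normc z.
Proof. by rewrite -lecR rmorphD /= -!normcR ler_normD. Qed.

Lemma l2sum_ge0 f : (0 <= l2sum f)%E.
Proof. by apply: esum_ge0 => i _; rewrite lee_fin sqr_ge0. Qed.

Lemma le_esumZ (c : R) (a : I -> \bar R) : 0 <= c ->
  (forall i, 0 <= a i)%E ->
  (\esum_(i in [set: I]) (c%:E * a i) <= c%:E * \esum_(i in [set: I]) a i)%E.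
Proof.
move=> c0 a0; apply: ge_ereal_sup => _ [X [finX _] <-].
rewrite -ge0_mule_fsumr// lee_wpmul2l ?lee_fin//.
by apply: ereal_sup_ubound; exists X.
Qed.

Lemma esumZ (c : R) (a : I -> \bar R) : 0 <= c ->
  (forall i, 0 <= a i)%E ->
  (\esum_(i in [set: I]) (c%:E * a i) = c%:E * \esum_(i in [set: I]) a i)%E.
Proof.
rewrite le_eqVlt => /predU1P[<- a0|c0 a0].
  by rewrite mul0e esum1// => i _; rewrite mul0e.
apply/eqP; rewrite eq_le le_esumZ ?(ltW c0)//=.
rewrite -lee_pdivlMl//.
apply: le_trans (le_esumZ _ _) => //; last first.
- by move=> i; rewrite mule_ge0// lee_fin ltW.
- by rewrite invr_ge0 ltW.
by apply: le_esum => i _; rewrite muleA -EFinM mulVf ?gt_eqF// mul1e.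
Qed.

Lemma l2sumZ (c : R[i]) f : l2sum (c *: f)%R = ((normc c ^+ 2)%:E * l2sum f)%E.
Proof.
rewrite /l2sum -esumZ ?sqr_ge0//; last by move=> i; rewrite lee_fin sqr_ge0.
by apply: eq_esum => i _; rewrite -EFinM -exprMn -Normc.normcM.
Qed.

Lemma l2sumD (t : R) f g : 0 < t ->
  (l2sum (f + g)%R <= (1 + t)%:E * l2sum f + (1 + t^-1)%:E * l2sum g)%E.
Proof.
move=> t0; have s0 : 0 < t^-1 by rewrite invr_gt0.
have sq0 (h : I -> R[i]) i : (0 <= (normc (h i) ^+ 2)%:E)%E.
  by rewrite lee_fin sqr_ge0.
have [t1 s1] : 0 <= 1 + t /\ 0 <= 1 + t^-1 by split; rewrite addr_ge0// ltW.
rewrite /l2sum -!esumZ//.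
rewrite -esumD; last 2 first.
- by move=> i _; rewrite mule_ge0.
- by move=> i _; rewrite mule_ge0.
apply: le_esum => i _; rewrite -!EFinM -EFinD lee_fin.
have le1 : normc (f i + g i) ^+ 2 <= (normc (f i) + normc (g i)) ^+ 2.
  by rewrite lerXn2r ?nnegrE ?addr_ge0 ?normc_ge0// ler_normcD.
apply: (le_trans le1); rewrite -subr_ge0.
set x := normc _; set y := normc _.
have -> : (1 + t) * x ^+ 2 + (1 + t^-1) * y ^+ 2 - (x + y) ^+ 2 =
          t^-1 * (t * x - y) ^+ 2 by field; rewrite gt_eqF.
by rewrite mulr_ge0 ?sqr_ge0// ltW.
Qed.

Lemma square_summable_submod_closed : submod_closed square_summable.
Proof.
split=> [|c f g]; rewrite !unfold_in => /=.
  by rewrite /l2sum esum1// => i _; rewrite Normc.normc0 expr0n.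
move=> f_lty g_lty; apply: le_lt_trans (l2sumD _ _ ltr01) _.
by rewrite l2sumZ lte_add_pinfty// ?lte_mul_pinfty ?mule_ge0 ?l2sum_ge0 ?lee_fin
  ?sqr_ge0 ?addr_ge0 ?invr_ge0// lte_mul_pinfty ?l2sum_ge0 ?lee_fin ?sqr_ge0.
Qed.

HB.instance Definition _ := GRing.isSubmodClosed.Build _ _ square_summable
  square_summable_submod_closed.

End SquareSummable.

Record ell2 (R : realType) (I : choiceType) := Ell2 {
  ell2_val :> I -> R[i];
  ell2_valP : ell2_val \in square_summable }.

Section Ell2.
Context {R : realType} {I : choiceType}.
Implicit Types f g : ell2 R I.

HB.instance Definition _ := [isSub for @ell2_val R I].
HB.instance Definition _ := [Choice of ell2 R I by <:].
HB.instance Definition _ := [SubChoice_isSubLmodule of ell2 R I by <:].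

Definition ell2_norm f : R := Num.sqrt (fine (l2sum f)).

Lemma l2sum_fin f : l2sum f \is a fin_num.
Proof. by rewrite ge0_fin_numE ?l2sum_ge0//; exact: ell2_valP. Qed.

Lemma ell2_norm_ge0 f : 0 <= ell2_norm f.
Proof. exact: sqrtr_ge0. Qed.

Lemma sqr_ell2_norm f : (ell2_norm f ^+ 2)%:E = l2sum f.
Proof. by rewrite sqr_sqrtr ?fine_ge0 ?l2sum_ge0// fineK// l2sum_fin. Qed.

Lemma ell2_norm_eq0 f : ell2_norm f = 0 -> f = 0.
Proof.
move=> f0; have s0 : l2sum f = 0%E by rewrite -sqr_ell2_norm f0 expr0n.
apply/val_inj/funext => i /=; apply: Normc.eq0_normc; apply/eqP.
rewrite -sqrf_eq0 eq_le sqr_ge0 andbT -lee_fin (_ : 0%:E = l2sum f)//.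
rewrite -(@esum_set1 R I i (fun j => (normc (f j) ^+ 2)%:E)) ?lee_fin ?sqr_ge0//.
rewrite [leLHS]esum_mkcond; apply: le_esum => j _.
by case: ifP => // _; rewrite lee_fin sqr_ge0.
Qed.

Lemma ell2_normZ (c : R[i]) f : ell2_norm (c *: f) = normc c * ell2_norm f.
Proof.
apply/eqP; rewrite -(@eqrXn2 _ 2)// ?mulr_ge0 ?ell2_norm_ge0 ?normc_ge0//.
apply/eqP/EFin_inj.
by rewrite sqr_ell2_norm exprMn [RHS]EFinM sqr_ell2_norm l2sumZ.
Qed.

Lemma ler_ell2_normD f g : ell2_norm (f + g) <= ell2_norm f + ell2_norm g.
Proof.
have [/ell2_norm_eq0->|f0] := eqVneq (ell2_norm f) 0.
  by rewrite add0r lerDr ell2_norm_ge0.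
have [/ell2_norm_eq0->|g0] := eqVneq (ell2_norm g) 0.
  by rewrite addr0 lerDl ell2_norm_ge0.
have pf : 0 < ell2_norm f by rewrite lt0r f0 ell2_norm_ge0.
have pg : 0 < ell2_norm g by rewrite lt0r g0 ell2_norm_ge0.
rewrite -ler_sqr ?nnegrE ?addr_ge0 ?ell2_norm_ge0// -lee_fin sqr_ell2_norm.
apply: le_trans (l2sumD f g (divr_gt0 pg pf)) _.
rewrite -!sqr_ell2_norm -!EFinM -EFinD lee_fin le_eqVlt; apply/orP; left.
by apply/eqP; field; rewrite f0 g0.
Qed.

Let nm f : R[i] := (ell2_norm f)%:C.

Let nmD f g : nm (f + g) <= nm f + nm g.
Proof. by rewrite -rmorphD lecR ler_ell2_normD. Qed.

Let nmZ (c : R[i]) f : nm (c *: f) = `|c| * nm f.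
Proof. by rewrite normcR -rmorphM /nm ell2_normZ. Qed.

Let nm_eq0 f : nm f = 0 -> f = 0.
Proof. by move=> /complexI; exact: ell2_norm_eq0. Qed.

HB.instance Definition _ :=
  Lmodule_isNormed.Build R[i] (ell2 R I) nmD nmZ nm_eq0.

Lemma ell2_normE f : `|f| = (ell2_norm f)%:C.
Proof. by []. Qed.

Lemma ell2_addE f g i : (f + g) i = f i + g i.
Proof. by []. Qed.

Lemma ell2_scaleE (c : R[i]) f i : (c *: f) i = c * f i.
Proof. by []. Qed.

Definition ell2_delta_fun (i : I) : I -> R[i] := fun j => (j == i)%:R.

Lemma ell2_delta_summable i : ell2_delta_fun i \in square_summable.
Proof.
rewrite unfold_in /= /l2sum (_ : esum _ _ = 1%:E) ?ltry//.
rewrite -(@esum_set1 R I i (fun=> 1%:E)) ?lee_fin// [RHS]esum_mkcond.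
apply: eq_esum => j _; rewrite /ell2_delta_fun.
have [->|/eqP ji] := eqVneq j i.
  by rewrite mem_set// Normc.normc1 expr1n.
by rewrite memNset// Normc.normc0 expr0n.
Qed.

(* The orthonormal basis vector indexed by [i]. *)
Definition ell2_delta (i : I) : ell2 R I := Ell2 (ell2_delta_summable i).

End Ell2.

(* Boundedness of a linear map near 0 is the existence of an operator-norm bound,
   and is equivalent to continuity (lemmas [linear_boundedP] and
   [linear_bounded_continuous]). *)
Record bounded_op (K : numFieldType) (V : normedModType K) := BoundedOp {
  bounded_op_val :> {linear V -> V};
  bounded_op_bounded : bounded_near bounded_op_val (nbhs (0 : V)) }.

(* Only the normed structure of a Hilbert space enters this notion, which is
   therefore stated for an arbitrary normed module. *)
Definition joint_right_spectrum (K : numFieldType) (V : normedModType K)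
    (n : nat) (A : 'I_n -> bounded_op V) : set 'rV[K]_n :=
  [set lam | ~ exists B : 'I_n -> bounded_op V,
     forall x : V, \sum_(i < n) (A i (B i x) - lam 0 i *: B i x) = x].

Section LeftCreation.
Context {R : realType} {n : nat}.
(* The free semigroup is the type of words, with concatenation and [::]. *)
Local Notation H := (ell2 R (seq 'I_n)).
Implicit Types (i : 'I_n) (f : H).

(* The values of the operator that maps the basis vector of [w] to that of
   [i :: w]; see [left_creation_delta]. *)
Definition left_creation_fun i f (w : seq 'I_n) : R[i] :=
  if w is j :: v then if j == i then f v else 0 else 0.

Lemma l2sum_left_creation i f : l2sum (left_creation_fun i f) = l2sum f.
Proof.
rewrite /l2sum [RHS](_ : _ = \esum_(w in [set i :: v | v in [set: seq 'I_n]])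
    (normc (left_creation_fun i f w) ^+ 2)%:E); last first.
  rewrite esum_image; last by move=> u v _ _ [].
  by apply: eq_esum => v _; rewrite /left_creation_fun eqxx.
rewrite [RHS]esum_mkcond; apply: eq_esum => w _.
case: ifPn => // nw; suff -> : left_creation_fun i f w = 0.
  by rewrite Normc.normc0 expr0n.
case: w nw => //= j v; have [->|//] := eqVneq j i.
by move=> /negP[]; rewrite inE; exists v.
Qed.

Lemma left_creation_summable i f : left_creation_fun i f \in square_summable.
Proof. by rewrite unfold_in /= l2sum_left_creation; exact: ell2_valP. Qed.

Definition left_creation_map i f : H := Ell2 (left_creation_summable i f).

Lemma left_creation_is_linear i : linear (left_creation_map i).
Proof.
move=> c f g; apply/val_inj/funext => w.
rewrite [LHS]/= [RHS](_ : _ =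
  c * left_creation_fun i f w + left_creation_fun i g w)//.
case: w => [|j v] /=; first by rewrite mulr0 addr0.
by case: eqP => // _; rewrite mulr0 addr0.
Qed.

HB.instance Definition _ i :=
  GRing.isLinear.Build R[i] H H *:%R (left_creation_map i)
    (left_creation_is_linear i).

Lemma left_creation_isometry i f : `|left_creation_map i f| = `|f|.
Proof. by rewrite !ell2_normE /ell2_norm l2sum_left_creation. Qed.

Lemma left_creation_bounded i :
  bounded_near (left_creation_map i) (nbhs (0 : H)).
Proof.
apply/(linear_boundedP (left_creation_map i)).
near=> r => f; by rewrite left_creation_isometry ler_peMl.
Unshelve. all: by end_near. Qed.

Definition left_creation i : bounded_op H :=
  BoundedOp (left_creation_bounded i).

Lemma left_creation_delta i (w : seq 'I_n) :
  left_creation i (ell2_delta w) = ell2_delta (i :: w).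
Proof.
apply/val_inj/funext => -[|j v] //=.
by rewrite /ell2_delta_fun eqseq_cons; case: eqP.
Qed.

End LeftCreation.
Arguments left_creation : clear implicits.

Definition unit_ball (R : realType) (n : nat) : set 'rV[R[i]]_n :=
  [set lam | Num.sqrt (\sum_(i < n) normc (lam 0 i) ^+ 2) < 1].
Arguments unit_ball : clear implicits.

(* Main.v *)
(** If [|lam| <= 1] and [\sum_i (L_i - lam_i) B_i = 1], put [g_i = B_i xi_1] and
    pair with the homogeneous pieces [\sum_(|w| = k) f(w) lam_w] of evaluation
    at [lam]: the resulting sequence [c_k] is constantly [-1], whereas
    Cauchy-Schwarz makes it square summable; this treats the interior and the
    boundary of the ball at once. If [|lam| > 1], then [mu = conj lam / |lam|^2]
    has [\sum_i lam_i mu_i = 1] and [|mu| < 1], so that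
    [\sum_i (L_i - lam_i) (- mu_i) = 1 - \sum_i mu_i L_i] is invertible. *)
Require Import Defs.
From HB Require Import structures.
From mathcomp Require Import all_boot all_order all_algebra complex.
From mathcomp Require Import all_classical all_reals all_analysis.
From mathcomp Require Import ring lra.

Set Implicit Arguments.
Unset Strict Implicit.
Unset Printing Implicit Defensive.
Import Order.TTheory GRing.Theory Num.Theory.
Import numFieldNormedType.Exports.
Import ComplexField.

Local Open Scope classical_set_scope.
Local Open Scope complex_scope.
Local Open Scope ring_scope.

(** * Cauchy-Schwarz and weighted triangle inequalities for finite sums *)

Section FiniteSums.
Context {R : realType}.

Lemma sum_mul_sqr_le (I : finType) (a b : I -> R) :
  \sum_i a i ^+ 2 <= 1 -> (\sum_i a i * b i) ^+ 2 <= \sum_i b i ^+ 2.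
Proof.
move=> a1.
have E s : \sum_i (b i - s * a i) ^+ 2 =
    \sum_i b i ^+ 2 - 2 * s * (\sum_i a i * b i) + s ^+ 2 * \sum_i a i ^+ 2.
  rewrite !mulr_sumr -sumrB -big_split /=.
  by apply: eq_bigr => i _; ring.
(* Choosing [s] equal to the inner product gives 0 <= |b|^2 - 2 s^2 + s^2 |a|^2 <= |b|^2 - s^2, with
   no division by |a|^2. *)
move: (\sum_i a i * b i) E => s /(_ s) E.
have : 0 <= \sum_i (b i - s * a i) ^+ 2.
  by apply: sumr_ge0 => i _; exact: sqr_ge0.
have : s ^+ 2 * \sum_i a i ^+ 2 <= s ^+ 2 by rewrite ler_piMr ?sqr_ge0.
by rewrite E; lra.
Qed.

Lemma normc_sum_le (I : finType) (z : I -> R[i]) :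
  normc (\sum_i z i) <= \sum_i normc (z i).
Proof.
elim/big_ind2: _ => [|x a y b xa yb|//]; first by rewrite Normc.normc0.
by apply: le_trans (ler_normcD _ _) _; exact: lerD.
Qed.

Lemma normc_sum_mul_sqr_le (I : finType) (a b : I -> R[i]) :
  \sum_i normc (a i) ^+ 2 <= 1 ->
  normc (\sum_i a i * b i) ^+ 2 <= \sum_i normc (b i) ^+ 2.
Proof.
move=> a1; apply: le_trans (sum_mul_sqr_le (fun i => normc (b i)) a1).
rewrite lerXn2r ?nnegrE ?normc_ge0//.
  by apply: sumr_ge0 => i _; rewrite mulr_ge0 ?normc_ge0.
apply: le_trans (normc_sum_le _) _; apply: ler_sum => i _.
by rewrite Normc.normcM.
Qed.

(** After the triangle inequality the gap is a nonnegative multiple of a square. A large [t] brings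
    the weight on [y] close to 1, which lets a contraction survive squaring. *)
Lemma normcD_sqr_le (t : R) (x y : R[i]) : 0 < t ->
  normc (x + y) ^+ 2 <= (1 + t) * normc x ^+ 2 + (1 + t^-1) * normc y ^+ 2.
Proof.
move=> t0; apply: (@le_trans _ _ ((normc x + normc y) ^+ 2)).
  by rewrite lerXn2r ?nnegrE ?addr_ge0 ?normc_ge0// ler_normcD.
rewrite -subr_ge0.
have -> : (1 + t) * normc x ^+ 2 + (1 + t^-1) * normc y ^+ 2 -
    (normc x + normc y) ^+ 2 = t^-1 * (t * normc x - normc y) ^+ 2.
  by field; rewrite gt_eqF.
by rewrite mulr_ge0 ?sqr_ge0// ltW// invr_gt0.
Qed.

End FiniteSums.

(** * Exhaustion of the free semigroup by words of bounded length *)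

Section Words.
Context {n : nat}.

Fixpoint words_lt (N : nat) : seq (seq 'I_n) :=
  if N is N'.+1
  then [::] :: [seq i :: w | i <- enum 'I_n, w <- words_lt N'] else [::].

Lemma mem_words_lt N (w : seq 'I_n) : (w \in words_lt N) = (size w < N)%N.
Proof.
elim: N w => [|N IH] [|i w] //=; rewrite in_cons /= ltnS -IH.
apply/allpairsP/idP => [[[j v] /= [_ vN [_ ->]]]//|wN].
by exists (i, w); rewrite /= mem_enum.
Qed.

Lemma words_lt_uniq N : uniq (words_lt N).
Proof.
elim: N => //= N IH; rewrite allpairs_uniq ?enum_uniq//; last first.
  by move=> [i v] [j w] _ _ /= [-> ->].
by rewrite andbT; apply/allpairsP => -[[i w] []].
Qed.

Lemma sum_words_ltS (V : nmodType) N (F : seq 'I_n -> V) :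
  \sum_(w <- words_lt N.+1) F w =
  F [::] + \sum_(i < n) \sum_(w <- words_lt N) F (i :: w).
Proof. by rewrite /= big_cons big_allpairs_dep big_enum. Qed.

Context {R : realType}.

Lemma sum_words_lt_le_l2sum N (f : seq 'I_n -> R[i]) :
  ((\sum_(w <- words_lt N) normc (f w) ^+ 2)%:E <= l2sum f)%E.
Proof.
apply: esum_ge; exists [set` words_lt N]; first by split=> //; exact: finite_seq.
by rewrite -fsbig_seq ?words_lt_uniq// sumEFin.
Qed.

(** Every finite set of words lies in some [words_lt N], so the bound passes to the supremum over
    finite sets that defines [l2sum]. *)
Lemma l2sum_le (f : seq 'I_n -> R[i]) (M : R) :
  (forall N, \sum_(w <- words_lt N) normc (f w) ^+ 2 <= M) ->
  (l2sum f <= M%:E)%E.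
Proof.
move=> fM; apply: ge_ereal_sup => _ [X [/finite_seqP[s ->] _] <-].
pose N := (\max_(w <- s) size w).+1.
apply: (@le_trans _ _ (\sum_(w \in [set` words_lt N]) (normc (f w) ^+ 2)%:E)).
  apply: lee_fsum_nneg_subset.
  - exact: finite_seq.
  - exact: finite_seq.
  - move=> w; rewrite !mem_setE => ws; rewrite mem_words_lt ltnS.
    by apply: leq_bigmax_seq.
  - by move=> w _; rewrite lee_fin sqr_ge0.
by rewrite -fsbig_seq ?words_lt_uniq// sumEFin lee_fin.
Qed.

End Words.

(** * Evaluation of homogeneous components at [lam] *)

Section GradedEvaluation.
Context {R : realType} {n : nat}.
Variable lam : 'I_n -> R[i].
Implicit Types f g : seq 'I_n -> R[i].

(* The sum of [f w * lam_w] over the words [w] of length [k], where [lam_w] is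
   the product of the [lam i] over the letters [i] of [w]. *)
Fixpoint level_eval (k : nat) f : R[i] :=
  if k is k'.+1
  then \sum_(i < n) lam i * level_eval k' (fun w => f (i :: w)) else f [::].

Lemma level_evalZD k c f g :
  level_eval k (fun w => c * f w + g w) = c * level_eval k f + level_eval k g.
Proof.
elim: k f g => //= k IH f g; rewrite mulr_sumr -big_split /=.
by apply: eq_bigr => i _; rewrite IH; ring.
Qed.

Lemma level_eval0 k : level_eval k (fun=> 0) = 0.
Proof. by elim: k => //= k IH; rewrite big1// => i _; rewrite IH mulr0. Qed.

Lemma level_eval_sum k (I : finType) (F : I -> seq 'I_n -> R[i]) :
  level_eval k (fun w => \sum_i F i w) = \sum_i level_eval k (F i).
Proof.
elim: k F => //= k IH F; rewrite exchange_big /=.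
by apply: eq_bigr => i _; rewrite IH mulr_sumr.
Qed.

(** Every word in the support of [L_i f] begins with [i], so only the [i]-th branch of the recursion
    survives. *)
Lemma level_eval_left_creation k i (f : ell2 R (seq 'I_n)) :
  level_eval k.+1 (left_creation_fun i f) = lam i * level_eval k f.
Proof.
rewrite /= (bigD1 i)//= eqxx big1 ?addr0// => j /negPf ji.
by rewrite ji level_eval0 mulr0.
Qed.

(** Induction on [N]: Cauchy-Schwarz over the first letter costs no constant since |lam| <= 1, and
    the induction hypothesis applies to each [fun w => f (i :: w)]. *)
Lemma level_eval_sqr_sum_le N f : \sum_i normc (lam i) ^+ 2 <= 1 ->
  \sum_(k < N) normc (level_eval k f) ^+ 2 <=
  \sum_(w <- words_lt N) normc (f w) ^+ 2.
Proof.
move=> lam1; elim: N f => [|N IH] f; first by rewrite big_ord0 big_nil.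
rewrite big_ord_recl sum_words_ltS lerD2l.
apply: (@le_trans _ _ (\sum_(k < N) \sum_(i < n)
    normc (level_eval k (fun w => f (i :: w))) ^+ 2)).
  by apply: ler_sum => k _; exact: normc_sum_mul_sqr_le.
by rewrite exchange_big; apply: ler_sum => i _; exact: IH.
Qed.

End GradedEvaluation.

(** * Points of the closed ball belong to the spectrum *)

Section Spectrum.
Context {R : realType} {n : nat}.
Local Notation H := (ell2 R (seq 'I_n)).

Lemma ell2_sum_apply (I : finType) (F : I -> H) w :
  (\sum_i F i) w = \sum_i F i w.
Proof. by elim/big_ind2: _ => // x1 x2 y1 y2 <- <-. Qed.

Lemma no_right_inverse_vector (lam : 'I_n -> R[i]) (g : 'I_n -> H) :
  \sum_i normc (lam i) ^+ 2 <= 1 ->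
  \sum_(i < n) (left_creation R n i (g i) - lam i *: g i) <> ell2_delta [::].
Proof.
move=> lam1 gE.
pose c k := \sum_i lam i * level_eval lam k (g i).
have gw w : ell2_delta_fun [::] w =
    \sum_i (- lam i * g i w + left_creation_fun i (g i) w).
  rewrite -[LHS]/(ell2_delta [::] w) -gE ell2_sum_apply.
  apply: eq_bigr => i _; rewrite [RHS]addrC mulNr.
  by rewrite -[RHS]/((left_creation R n i (g i) - lam i *: g i) w).
have ck k : level_eval lam k (ell2_delta_fun [::]) =
    - c k + \sum_i level_eval lam k (left_creation_fun i (g i)).
  rewrite (funext gw) level_eval_sum -sumrN -big_split; apply: eq_bigr => i _.
  by rewrite level_evalZD mulNr.
(* At level 0 the creation terms vanish, so 1 = - c_0. At level k+1 the basis vector of the empty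
   word evaluates to 0 and the creation terms sum to c_k, so c_(k+1) = c_k. *)
have c1 k : c k = -1.
  elim: k => [|k IH].
    by have := ck 0%N; rewrite /= [X in _ + X]big1// addr0 => /(congr1 -%R); rewrite opprK => <-.
  have := ck k.+1.
  rewrite (eq_bigr _ (fun i _ => level_eval_left_creation lam k i (g i))).
  rewrite -/(c k) IH [LHS](_ : _ = 0).
    by move=> /esym/eqP; rewrite addrC subr_eq0 => /eqP.
  by rewrite /= big1// => i _; rewrite level_eval0 mulr0.
pose M := \sum_i ell2_norm (g i) ^+ 2.
(* Here [N] is the sum of |c_k|^2 over k < N. Cauchy-Schwarz over [i] at each level, then summation
   over the levels, bounds it by [M], against the Archimedean property. *)
have NM (N : nat) : N%:R <= M.
  apply: (@le_trans _ _ (\sum_(k < N) \sum_i normc (level_eval lam k (g i)) ^+ 2)).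
    rewrite -[N in leLHS]card_ord -sum1_card natr_sum; apply: ler_sum => k _.
    apply: le_trans (normc_sum_mul_sqr_le _ lam1).
    by rewrite -/(c k) c1 normcN Normc.normc1 expr1n.
  rewrite exchange_big; apply: ler_sum => i _.
  apply: le_trans (level_eval_sqr_sum_le _ _ lam1) _.
  by rewrite -lee_fin sqr_ell2_norm sum_words_lt_le_l2sum.
by have := truncnS_gt M; rewrite ltNge NM.
Qed.

(** * Inverting [1 - \sum_i mu_i L_i] when |mu| < 1 *)

Section Resolvent.
Variable mu : 'I_n -> R[i].

(* The solution [g] of [g - \sum_i mu_i L_i g = f]. *)
Fixpoint resolvent_fun (f : seq 'I_n -> R[i]) (w : seq 'I_n) : R[i] :=
  if w is i :: v then f w + mu i * resolvent_fun f v else f [::].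

Let q := \sum_i normc (mu i) ^+ 2.

(** Squaring the recursion with weight [t] and summing over words gives S_(N+1) <= (1 + t) M + rho
    S_N for the partial sums S_N, where rho = [(1 + t^-1) * q] < 1. Induction keeps S_N below the
    fixed point of this affine map. *)
Lemma resolvent_fun_words_le t M (f : seq 'I_n -> R[i]) N :
  0 < t -> (1 + t^-1) * q < 1 -> (l2sum f <= M%:E)%E ->
  \sum_(w <- words_lt N) normc (resolvent_fun f w) ^+ 2 <=
  (1 + t) / (1 - (1 + t^-1) * q) * M.
Proof.
move=> t0 rho1 fM; set rho := (1 + t^-1) * q; set C := _ / _.
have t1 : 0 <= 1 + t by rewrite addr_ge0// ltW.
have s1 : 0 <= 1 + t^-1 by rewrite addr_ge0// invr_ge0 ltW.
have M0 : 0 <= M by rewrite -lee_fin (le_trans (l2sum_ge0 f)).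
have rho_lt : 0 < 1 - rho by rewrite subr_gt0.
have CE : C * M = (1 + t) * M + rho * (C * M).
  by rewrite /C; field; rewrite gt_eqF.
elim: N => [|N IH].
  by rewrite big_nil mulr_ge0// divr_ge0// ltW.
rewrite sum_words_ltS.
apply: (@le_trans _ _ ((1 + t) * \sum_(w <- words_lt N.+1) normc (f w) ^+ 2 +
   rho * \sum_(w <- words_lt N) normc (resolvent_fun f w) ^+ 2)); last first.
  rewrite CE lerD// ler_wpM2l//.
  - by rewrite -lee_fin (le_trans (sum_words_lt_le_l2sum _ _)).
  - by rewrite mulr_ge0// sumr_ge0// => i _; exact: sqr_ge0.
rewrite sum_words_ltS mulrDr -addrA lerD//.
  by rewrite ler_peMl ?sqr_ge0// lerDl ltW.
rewrite /rho /q -mulrA mulr_suml !mulr_sumr -big_split /=; apply: ler_sum => i _.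
rewrite !mulr_sumr -big_split /=; apply: ler_sum => w _.
by rewrite -exprMn -Normc.normcM; exact: normcD_sqr_le.
Qed.

Hypothesis mu1 : q < 1.

(** With this weight the contraction factor [(1 + t^-1) * q] becomes [2 * q / (1 + q)], which
    [q < 1] keeps below 1. *)
Let t := (1 + q) / (1 - q).
Let C := (1 + t) / (1 - (1 + t^-1) * q).

Let q0 : 0 <= q.
Proof. by apply: sumr_ge0 => i _; exact: sqr_ge0. Qed.

Let t_gt0 : 0 < t.
Proof. by rewrite divr_gt0 ?subr_gt0// ltr_wpDr. Qed.

Let rho_lt1 : (1 + t^-1) * q < 1.
Proof.
have -> : (1 + t^-1) * q = 2 * q / (1 + q).
  by rewrite /t; field; rewrite !gt_eqF ?subr_gt0 ?ltr_wpDr.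
rewrite ltr_pdivrMr ?ltr_wpDr// mul1r.
by move: mu1; lra.
Qed.

Lemma resolvent_fun_l2sum (f : H) :
  (l2sum (resolvent_fun f) <= (C * ell2_norm f ^+ 2)%:E)%E.
Proof.
apply: l2sum_le => N; apply: resolvent_fun_words_le => //.
by rewrite sqr_ell2_norm.
Qed.

Lemma resolvent_summable (f : H) : resolvent_fun f \in square_summable.
Proof.
rewrite unfold_in /=; apply: le_lt_trans (resolvent_fun_l2sum f) _.
exact: ltry.
Qed.

Definition resolvent_map (f : H) : H := Ell2 (resolvent_summable f).

Lemma resolvent_map_norm_sqr_le (f : H) :
  ell2_norm (resolvent_map f) ^+ 2 <= C * ell2_norm f ^+ 2.
Proof. by rewrite -lee_fin sqr_ell2_norm resolvent_fun_l2sum. Qed.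

Lemma resolvent_map_is_linear : linear resolvent_map.
Proof.
move=> c f g; apply/val_inj/funext => w /=.
rewrite -[RHS]/(c * resolvent_fun f w + resolvent_fun g w).
elim: w => //= i w ->.
rewrite -[LHS]/(c * f (i :: w) + g (i :: w) +
  mu i * (c * resolvent_fun f w + resolvent_fun g w)); ring.
Qed.

HB.instance Definition _ :=
  GRing.isLinear.Build R[i] H H *:%R resolvent_map resolvent_map_is_linear.

Lemma resolvent_map_eq (f : H) :
  resolvent_map f - \sum_i mu i *: left_creation_map i (resolvent_map f) = f.
Proof.
apply/val_inj/funext => w.
rewrite -[LHS]/(resolvent_map f w -
  (\sum_i mu i *: left_creation_map i (resolvent_map f)) w) ell2_sum_apply.
rewrite (eq_bigr (fun i => mu i * left_creation_fun i (resolvent_map f) w))//.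
case: w => [|i w] /=; first by rewrite big1 ?subr0// => i _; rewrite mulr0.
rewrite (bigD1 i)//= eqxx big1 ?addr0 ?addrK// => j /negPf ji.
by rewrite eq_sym ji mulr0.
Qed.

Lemma scaled_resolvent_bounded (c : R[i]) :
  bounded_near (c \*: resolvent_map) (nbhs (0 : H)).
Proof.
apply/(@linear_boundedP _ _ _ (c \*: resolvent_map)).
have C0 : 0 <= C.
  by rewrite divr_ge0 ?subr_ge0 ?(ltW rho_lt1)// addr_ge0// ltW.
near=> r => f /=.
rewrite normrZ; apply: (@le_trans _ _ (`|c| * (Num.sqrt C)%:C * `|f|)).
  rewrite -mulrA ler_wpM2l// !ell2_normE -rmorphM lecR.
  rewrite -ler_sqr ?nnegrE ?mulr_ge0 ?ell2_norm_ge0 ?sqrtr_ge0//.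
  rewrite exprMn (sqr_sqrtr C0).
  exact: resolvent_map_norm_sqr_le.
rewrite ler_wpM2r//; near: r; apply: nbhs_pinfty_ge.
by rewrite realM// ?normr_real// ger0_real// ler0c sqrtr_ge0.
Unshelve. all: by end_near. Qed.

Definition scaled_resolvent (c : R[i]) : bounded_op H :=
  BoundedOp (scaled_resolvent_bounded c).

End Resolvent.

(** * Points outside the closed ball, and the resulting spectrum *)

Lemma right_inverse_outside_ball (lam : 'rV[R[i]]_n) :
  1 < \sum_i normc (lam 0 i) ^+ 2 ->
  exists B : 'I_n -> bounded_op H, forall x : H,
    \sum_(i < n) (left_creation R n i (B i x) - lam 0 i *: B i x) = x.
Proof.
set s := \sum_i _ => s1; have s0 : 0 < s by exact: lt_trans s1.
pose mu i := (lam 0 i)^* / s%:C.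
have normc_conj (z : R[i]) : normc z^* = normc z.
  by case: z => a b /=; rewrite sqrrN.
have mulcconj (z : R[i]) : z * z^* = (normc z ^+ 2)%:C.
  by rewrite rmorphXn /= -normcR sqr_normc.
have mu1 : \sum_i normc (mu i) ^+ 2 < 1.
  rewrite (_ : \sum_i _ = s^-1); first by rewrite invf_lt1.
  rewrite -[RHS](_ : s * s^-1 ^+ 2 = _); last by field; rewrite gt_eqF.
  rewrite mulr_suml; apply: eq_bigr => i _.
  rewrite Normc.normcM Normc.normcV normc_conj exprMn.
  by rewrite (_ : normc s%:C = s)// /= expr0n addr0 sqrtr_sqr gtr0_norm.
have lam_mu : \sum_i lam 0 i * mu i = 1.
  rewrite (eq_bigr (fun i => (normc (lam 0 i) ^+ 2)%:C * s%:C^-1)); last first.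
    by move=> i _; rewrite mulrA mulcconj.
  by rewrite -mulr_suml -rmorph_sum divff//= eq_complex /= gt_eqF.
exists (fun i => scaled_resolvent mu1 (- mu i)) => x.
(* Multiplying the leading resolvent term by 1 = [\sum_i lam 0 i * mu i] splits the resolvent
   equation into one summand per letter, of the form (L_i - lam_i)(- mu_i g). *)
rewrite -[RHS](resolvent_map_eq mu1) -[X in _ = X - _]scale1r -lam_mu scaler_suml.
rewrite -sumrB; apply: eq_bigr => i _ /=.
by rewrite linearZ /= scalerA mulrN !scaleNr opprK addrC.
Qed.

Lemma joint_right_spectrum_left_creation :
  joint_right_spectrum (left_creation R n) =
  [set lam | \sum_i normc (lam 0 i) ^+ 2 <= 1].
Proof.
apply/seteqP; split=> lam /=.
  by move=> noB; rewrite leNgt; apply/negP => /right_inverse_outside_ball.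
by move=> lam1 [B /(_ (ell2_delta [::]))]; exact: no_right_inverse_vector.
Qed.

(** * The closure of the Euclidean unit ball *)

Lemma closure_unit_ball :
  closure (unit_ball R n) = [set lam | \sum_i normc (lam 0 i) ^+ 2 <= 1].
Proof.
(* Balls of row vectors are entrywise, whereas the unit ball is Euclidean; this lemma passes between
   the two descriptions. *)
have ballE (lam mu : 'rV[R[i]]_n) (e : R) : 0 < e ->
    (forall i, normc (lam 0 i - mu 0 i) < e) <-> ball lam e%:C mu.
  move=> e0; split=> [h|[_ h] i].
    split; first by rewrite ltcR.
    by move=> i j; rewrite (ord1 i) -ball_normE /= normcR ltcR.
  by have := h 0 i; rewrite -ball_normE /= normcR ltcR.
have sum0 (lam : 'rV[R[i]]_n) : 0 <= \sum_i normc (lam 0 i) ^+ 2.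
  by apply: sumr_ge0 => i _; exact: sqr_ge0.
have ltP (lam : 'rV[R[i]]_n) :
    unit_ball R n lam <-> \sum_i normc (lam 0 i) ^+ 2 < 1.
  by rewrite /unit_ball /= -{1}[1]sqrtr1 ltr_sqrt.
apply/seteqP; split=> lam /=.
- move=> lam_cl; rewrite leNgt; apply/negP; set s := \sum_i _ => s1.
  (* The loss 3e per coordinate comes from (|mu_i| + e)^2 <= |mu_i|^2 + 3e, valid for |mu_i| <= 1
     and e <= 1. *)
  have [e [e0 e1 ne]] : exists e, [/\ 0 < e, e <= 1 & n%:R * (3 * e) < s - 1].
    (* The factor [s] ensures e <= 1, and [n.+1] makes the last inequality strict and the
       denominator nonzero. *)
    clearbody s; exists ((s - 1) / (3 * s * n.+1%:R)).
    have s0 : 0 < s by exact: lt_trans s1.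
    have n0 : 0 < n.+1%:R :> R by [].
    have n1 : 1 <= n.+1%:R :> R by rewrite ler1n.
    have nn : n%:R < n.+1%:R :> R by rewrite ltr_nat.
    have nn0 : 0 <= n%:R :> R by [].
    move: (n%:R) (n.+1%:R) n0 n1 nn nn0 => m m' n0 n1 nn nn0.
    have d0 : 0 < 3 * s * m' by rewrite !mulr_gt0.
    split; first by rewrite divr_gt0// subr_gt0.
      by rewrite ler_pdivrMr// mul1r; nra.
    rewrite (_ : m * _ = (s - 1) * (m / (s * m'))); last first.
      by field; rewrite !gt_eqF.
    by rewrite gtr_pMr ?subr_gt0// ltr_pdivrMr ?mulr_gt0// mul1r; nra.
  have [|mu [/ltP mu1 /(ballE _ _ _ e0) lam_mu]] := lam_cl (ball lam e%:C).
    by apply: nbhsx_ballx; rewrite ltcR.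
  suff : s <= 1 + n%:R * (3 * e) by clearbody s; move: ne; lra.
  apply: (@le_trans _ _ (\sum_i (normc (mu 0 i) ^+ 2 + 3 * e))); last first.
    by rewrite big_split /= sumr_const card_ord -[_ *+ n]mulr_natl lerD2r ltW.
  apply: ler_sum => i _.
  have mui1 : normc (mu 0 i) <= 1.
    rewrite -(@expr_le1 _ 2)// ?normc_ge0//; apply: le_trans (ltW mu1).
    by rewrite (bigD1 i)//= lerDl sumr_ge0// => j _; exact: sqr_ge0.
  have : normc (lam 0 i) <= e + normc (mu 0 i).
    rewrite -[lam 0 i](subrK (mu 0 i)); apply: le_trans (ler_normcD _ _) _.
    by rewrite lerD2r ltW.
  have := normc_ge0 (lam 0 i); have := normc_ge0 (mu 0 i).
  by nra.
- move=> lam1 U /nbhs_ballP[z /= z0 zU].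
  (* Positivity in [R[i]] forces a zero imaginary part, so the radius is real. *)
  have [e e0 ze] : exists2 e : R, 0 < e & e%:C = z.
    by case: z z0 {zU} => a b /=; rewrite ltcE /= => /andP[/eqP -> ?]; exists a.
  rewrite -{z z0}ze in zU.
  (* This [r] is below both [e] and 1, so shrinking [lam] by the factor 1 - r enters the open ball
     and moves each coordinate by less than [e]. *)
  pose r := e / (1 + e).
  have e1 : 0 < 1 + e by rewrite addr_gt0.
  have r0 : 0 < r by rewrite divr_gt0.
  have re : r < e by rewrite ltr_pdivrMr// ltr_pMr// ltrDl.
  have r1 : r < 1 by rewrite ltr_pdivrMr// mul1r ltrDr.
  have normc_real (x : R) : 0 <= x -> normc x%:C = x.
    by move=> x0; rewrite /= expr0n addr0 sqrtr_sqr ger0_norm.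
  have lami1 i : normc (lam 0 i) <= 1.
    rewrite -(@expr_le1 _ 2)// ?normc_ge0//; apply: le_trans lam1.
    by rewrite (bigD1 i)//= lerDl sumr_ge0// => j _; exact: sqr_ge0.
  exists ((1 - r)%:C *: lam); split.
    apply/ltP; rewrite (eq_bigr (fun i => (1 - r) ^+ 2 * normc (lam 0 i) ^+ 2)).
      rewrite -mulr_sumr; apply: (@le_lt_trans _ _ ((1 - r) ^+ 2)).
        by rewrite ler_piMr ?sqr_ge0.
      by rewrite expr_lt1// ?subr_ge0 ?ltW// ltrBlDr ltrDl.
    move=> i _; rewrite mxE Normc.normcM exprMn normc_real// subr_ge0.
    exact: ltW.
  apply/zU/(ballE _ _ _ e0) => i; rewrite mxE.
  rewrite (_ : _ - _ = r%:C * lam 0 i); last by rewrite rmorphB rmorph1; ring.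
  rewrite Normc.normcM normc_real ?ltW//; apply: le_lt_trans re.
  by rewrite ler_piMr// ltW.
Qed.

End Spectrum.

Theorem theorem5p1 (R : realType) (n : nat) (hn : (2 <= n)%N) :
  joint_right_spectrum (left_creation R n) = closure (unit_ball R n).
Proof. by rewrite closure_unit_ball joint_right_spectrum_left_creation. Qed.
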